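(* Let $(U^k,V^k,P^k)_{k\ge 0}$ be a sequence generated by the ADMM iteration $$U^{k+1}\in\arg\min_{U}L(U,V^k,P^k),\qquad V^{k+1}\in\arg\min_{V}L(U^{k+1},V,P^k),\qquad P^{k+1}=P^k+\rho(V^{k+1}-HU^{k+1}),$$ and assume that $\frac{\rho}{2}-\frac{L_h}{\rho}-L_h>0$. Then there is a subsequence of $(U^k,V^k,P^k)$ which converges to a stationary point of $L(U,V,P)$.
   Context: Let $n\ge 1$; vectors $U,V,P,I$ lie in $\mathbb{R}^{n^2}$ (vectorized $n\times n$ images), $I\in\{0,1\}^{n^2}$ is a given binary target, $H\in\mathbb{R}^{n^2\times n^2}$ is a given matrix, and $D_x,D_y\in\mathbb{R}^{n^2\times n^2}$ are the first-order finite difference matrices in the horizontal and vertical directions; $DU=(D_xU,D_yU)$ and $\|DU\|_1=\|D_xU\|_1+\|D_yU\|_1$. $\odot$ is the entrywise product, and $1$ also denotes the all-ones vector. Constants $a>0$, $tr\in\mathbb{R}$, $\beta_1,\beta_2>0$, $\rho>0$ are fixed. $Sig_a(t)=\frac{1}{1+\exp(-a(t-tr))}$, applied entrywise, and $|V|^2$ is the entrywise squared modulus. Define $$h(V)=\|Sig_a(|V|^2)-I\|_2^2,$$ whose gradient $\nabla h$ is Lipschitz continuous; $L_h$ denotes a Lipschitz constant of $\nabla h$ with respect to $\|\cdot\|_2$. Define $f(U)=\beta_1\|DU\|_1+\beta_2\|U\odot(1-U)\|_1$ for $U$ satisfying the constraint $0\le U\le 1$ (entrywise), and $f(U)=+\infty$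 otherwise. The augmented Lagrangian is $$L(U,V,P)=f(U)+h(V)+\langle P,V-HU\rangle+\frac{\rho}{2}\|V-HU\|_2^2 .$$ The initial data $U^0,V^0,P^0$ are arbitrary given vectors. $\partial$ denotes the general (limiting) subdifferential. A stationary point of $L$ is a point $(U^*,V^*,P^* )$ with $0\in\partial L(U^*,V^*,P^* )$, i.e. $0\in\partial_U L(U^*,V^*,P^* )$, $\nabla_V L(U^*,V^*,P^* )=0$ and $\nabla_P L(U^*,V^*,P^* )=V^*-HU^*=0$. *)

(* Defs.v *)
From HB Require Import structures.
From mathcomp Require Import all_boot all_order all_algebra.
From mathcomp Require Import mathcomp_extra boolp classical_sets functions.
From mathcomp Require Import reals ereal topology normedtype.
From mathcomp Require Import sequences derive exp.
From mathcomp Require Import mxtens.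

Set Implicit Arguments.
Unset Strict Implicit.
Unset Printing Implicit Defensive.

Import Order.TTheory GRing.Theory Num.Theory.
Import numFieldNormedType.Exports.

Local Open Scope classical_set_scope.
Local Open Scope ring_scope.

(* The library norm on matrices is the sup norm, so the Euclidean and l1 norms
   are defined here.  The topology on column vectors is the library one, which
   is the usual topology of R^m. *)
Section euclidean.
Context {R : realType} {m : nat}.
Implicit Types u v x : 'cV[R]_m.

Definition dot u v : R := \sum_i u i 0 * v i 0.

Definition l1norm u : R := \sum_i `|u i 0|.

Definition l2norm u : R := Num.sqrt (\sum_i (u i 0) ^+ 2).

Definition hadamard u v : 'cV[R]_m := map2_mx *%R u v.

Definition gradient (g : 'cV[R]_m -> R) x : 'cV[R]_m :=
  \col_i 'D_(delta_mx i 0) g x.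

Definition has_gradient (g : 'cV[R]_m -> R) x v : Prop :=
  differentiable g x /\ gradient g x = v.

Definition l2_lipschitz (k : R) (g : 'cV[R]_m -> 'cV[R]_m) : Prop :=
  forall x y, l2norm (g x - g y) <= k * l2norm (x - y).

Definition argmin (F : 'cV[R]_m -> \bar R) : set 'cV[R]_m :=
  [set x | forall y, (F x <= F y)%E].

(* F y >= F x + <v, y - x> + o(|y - x|) as y -> x, with F x finite. *)
Definition regular_subdiff (F : 'cV[R]_m -> \bar R) x : set 'cV[R]_m :=
  [set v | F x \is a fin_num /\
    forall e : R, 0 < e -> \forall y \near x,
      (F x + (dot v (y - x) - e * l2norm (y - x))%:E <= F y)%E].

(* The general (limiting, Mordukhovich) subdifferential: limits of regular
   subgradients along sequences x_k -> x with F x_k -> F x. *)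
Definition limiting_subdiff (F : 'cV[R]_m -> \bar R) x : set 'cV[R]_m :=
  [set v | F x \is a fin_num /\
    exists x_ v_ : nat -> 'cV[R]_m,
      [/\ forall k, regular_subdiff F (x_ k) (v_ k),
          x_ @ \oo --> x,
          F (x_ k) @[k --> \oo] --> F x &
          v_ @ \oo --> v]].

End euclidean.

(* Value given to the sample following the last one: the last sample itself
   (Neumann condition), the first sample, or 0. *)
Inductive boundary := Replicate | Periodic | ZeroPad.

Section finite_differences.
Context {R : realType}.

(* (fdiff n bc *m x)_i = x_(i+1) - x_i *)
Definition fdiff (n : nat) (bc : boundary) : 'M[R]_n :=
  \matrix_(i < n, j < n)
    ((if (i.+1 < n)%N then val j == i.+1
      else match bc with
           | Replicate => j == i
           | Periodic => val j == 0%N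
           | ZeroPad => false
           end)%:R - (j == i)%:R).

(* Images are vectorized row by row: the pixel in row i and column j is the
   entry [mxtens_index (i, j)], of value i * n + j. *)
Definition diff_x (n : nat) (bc : boundary) : 'M[R]_(n * n) :=
  (1%:M : 'M[R]_n) *t fdiff n bc.

Definition diff_y (n : nat) (bc : boundary) : 'M[R]_(n * n) :=
  fdiff n bc *t (1%:M : 'M[R]_n).

End finite_differences.

Section model.
Context {R : realType}.

Definition sigmoid (a tr t : R) : R := (1 + expR (- a * (t - tr)))^-1.

Definition fidelity (N : nat) (a tr : R) (I V : 'cV[R]_N) : R :=
  l2norm (\col_i (sigmoid a tr (`|V i 0| ^+ 2)) - I) ^+ 2.

Definition regularizer (n : nat) (bc : boundary) (beta1 beta2 : R)
    (U : 'cV[R]_(n * n)) : \bar R :=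
  if [forall i, 0 <= U i 0 <= 1] then
    (beta1 * (l1norm (diff_x n bc *m U) + l1norm (diff_y n bc *m U))
     + beta2 * l1norm (hadamard U (const_mx 1 - U)))%:E
  else +oo%E.

Context {N : nat}.
Implicit Types U V P : 'cV[R]_N.

Definition aug_lagrangian (f : 'cV[R]_N -> \bar R) (h : 'cV[R]_N -> R)
    (H : 'M[R]_N) (rho : R) U V P : \bar R :=
  (f U + (h V + dot P (V - H *m U)
          + rho / 2 * l2norm (V - H *m U) ^+ 2)%:E)%E.

Definition admm (L : 'cV[R]_N -> 'cV[R]_N -> 'cV[R]_N -> \bar R)
    (H : 'M[R]_N) (rho : R) (U V P : nat -> 'cV[R]_N) : Prop :=
  forall k,
    [/\ argmin (fun W => L W (V k) (P k)) (U k.+1),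
        argmin (fun W => L (U k.+1) W (P k)) (V k.+1) &
        P k.+1 = P k + rho *: (V k.+1 - H *m U k.+1)].

(* L as a function on R^(3N), the triple (U, V, P) being stacked. *)
Definition uncurry3 (L : 'cV[R]_N -> 'cV[R]_N -> 'cV[R]_N -> \bar R)
    (z : 'cV[R]_(N + (N + N))) : \bar R :=
  L (usubmx z) (usubmx (dsubmx z)) (dsubmx (dsubmx z)).

(* Both the joint inclusion 0 \in dL(U, V, P) and its componentwise form are
   required.  The inclusion forces L U V P to be finite; for an augmented
   Lagrangian, L U is then finite everywhere, so that [fine] loses nothing. *)
Definition stationary (L : 'cV[R]_N -> 'cV[R]_N -> 'cV[R]_N -> \bar R)
    U V P : Prop :=
  [/\ limiting_subdiff (uncurry3 L) (col_mx U (col_mx V P)) 0,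
      limiting_subdiff (fun W => L W V P) U 0,
      has_gradient (fun W => fine (L U W P)) V 0 &
      has_gradient (fun W => fine (L U V W)) P 0].

End model.

(* Main.v *)
Require Import Defs.
From HB Require Import structures.
From mathcomp Require Import all_boot all_order all_algebra.
From mathcomp Require Import mathcomp_extra boolp classical_sets functions.
From mathcomp Require Import reals ereal topology normedtype.
From mathcomp Require Import sequences derive exp.
From mathcomp Require Import landau ring lra.

(* The optimality condition of the V-step together with the dual update gives
   P^k = - grad h(V^k) for k >= 1.  Hence the dual step costs at most
   (Lh^2 / rho) |V^(k+1) - V^k|^2 in the Lagrangian while the V-step gains
   (rho - Lh) / 2 |V^(k+1) - V^k|^2; the net gain is positive as soon as
   2 Lh < rho, which the assumption on rho implies.  Since 0 <= h is bounded with
   Lipschitz gradient, grad h is bounded, so the Lagrangian is bounded below along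
   the iterates and V^(k+1) - V^k and V^k - H U^k tend to 0.  Compactness is only
   needed for U^k, which lies in the unit box: V^k and P^k then converge along the
   same subsequence, to H Us and - grad h(H Us) where Us is the limit of U^k,
   and minimality of the U-step passes to the limit. *)

Set Implicit Arguments.
Unset Strict Implicit.
Unset Printing Implicit Defensive.

Import Order.TTheory GRing.Theory Num.Theory.
Import numFieldNormedType.Exports.

Local Open Scope classical_set_scope.
Local Open Scope ring_scope.

(** * The Euclidean norm *)

Section euclidean_theory.
Context {R : realType} {m : nat}.
Implicit Types (u v w x y : 'cV[R]_m) (c : R).

Lemma dotC u v : dot u v = dot v u.
Proof. by apply: eq_bigr => i _; rewrite mulrC. Qed.

Lemma dotDl u v w : dot (u + v) w = dot u w + dot v w.
Proof. by rewrite -big_split; apply: eq_bigr => i _; rewrite mxE mulrDl. Qed.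

Lemma dotZl c u v : dot (c *: u) v = c * dot u v.
Proof. by rewrite mulr_sumr; apply: eq_bigr => i _; rewrite mxE mulrA. Qed.

Lemma dotNl u v : dot (- u) v = - dot u v.
Proof. by rewrite -scaleN1r dotZl mulN1r. Qed.

Lemma dotBl u v w : dot (u - v) w = dot u w - dot v w.
Proof. by rewrite dotDl dotNl. Qed.

Lemma dotDr u v w : dot w (u + v) = dot w u + dot w v.
Proof. by rewrite dotC dotDl !(dotC w). Qed.

Lemma dotZr c u v : dot u (c *: v) = c * dot u v.
Proof. by rewrite dotC dotZl dotC. Qed.

Lemma dotNr u v : dot u (- v) = - dot u v.
Proof. by rewrite dotC dotNl dotC. Qed.

Lemma dotBr u v w : dot w (u - v) = dot w u - dot w v.
Proof. by rewrite dotDr dotNr. Qed.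

Lemma dot0r u : dot u 0 = 0.
Proof. by rewrite -(scale0r 0) dotZr mul0r. Qed.

Definition dotE := (dotDl, dotDr, dotBl, dotBr, dotNl, dotNr, dotZl, dotZr).

Lemma dot_ge0 u : 0 <= dot u u.
Proof. by apply: sumr_ge0 => i _; rewrite -expr2 sqr_ge0. Qed.

Lemma l2norm_sqr u : l2norm u ^+ 2 = dot u u.
Proof.
rewrite /l2norm sqr_sqrtr; first by apply: eq_bigr => i _; rewrite expr2.
by apply: sumr_ge0 => i _; exact: sqr_ge0.
Qed.

Lemma l2norm_ge0 u : 0 <= l2norm u.
Proof. exact: sqrtr_ge0. Qed.

Lemma l2normZ c u : l2norm (c *: u) = `|c| * l2norm u.
Proof.
apply/(@pexpIrn _ 2) => //; rewrite ?nnegrE ?mulr_ge0 ?l2norm_ge0//.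
by rewrite exprMn !l2norm_sqr !dotE real_normK ?num_real// expr2 mulrA.
Qed.

Lemma l2normN u : l2norm (- u) = l2norm u.
Proof. by rewrite -scaleN1r l2normZ normrN1 mul1r. Qed.

Lemma coord_le_l2norm u i : `|u i 0| <= l2norm u.
Proof.
rewrite -(@ler_pXn2r _ 2) ?nnegrE ?l2norm_ge0// l2norm_sqr real_normK ?num_real//.
rewrite /dot (bigD1 i)//= -expr2 lerDl.
by apply: sumr_ge0 => j _; rewrite -expr2 sqr_ge0.
Qed.

(** With [l2norm_le_normr], this makes the library sup norm and the Euclidean norm equivalent, so
    the topology and the little-o of the library can be used with [l2norm]. *)
Lemma normr_le_l2norm u : `|u| <= l2norm u.
Proof.
rewrite [leLHS]/Num.norm /= mx_normrE; apply/bigmax_leP; split.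
  exact: l2norm_ge0.
by move=> [i j] _ /=; rewrite (ord1 j); exact: coord_le_l2norm.
Qed.

Lemma l2norm_le_l1norm u : l2norm u <= l1norm u.
Proof.
rewrite -(@ler_pXn2r _ 2) ?nnegrE ?l2norm_ge0//; last exact: sumr_ge0.
rewrite l2norm_sqr expr2 {1}/l1norm mulr_suml; apply: ler_sum => i _.
rewrite (le_trans (ler_norm _))// normrM ler_wpM2l//.
by rewrite /l1norm (bigD1 i)//= lerDl; exact: sumr_ge0.
Qed.

Lemma l2norm_le_normr u : l2norm u <= m%:R * `|u|.
Proof.
apply: (le_trans (l2norm_le_l1norm u)).
have -> : m%:R * `|u| = \sum_(i < m) `|u|.
  by rewrite sumr_const card_ord mulr_natl.
apply: ler_sum => i _; rewrite [leRHS]/Num.norm /= mx_normrE.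
exact: (@le_bigmax _ _ _ _ (fun ij : 'I_m * 'I_1 => `|u ij.1 ij.2|) (i, 0)).
Qed.

Lemma cauchy_schwarz u v : `|dot u v| <= l2norm u * l2norm v.
Proof.
rewrite -(@ler_pXn2r _ 2) ?nnegrE ?mulr_ge0 ?l2norm_ge0//.
rewrite real_normK ?num_real// exprMn !l2norm_sqr.
(* [H] factors as [dot v v * (dot u u * dot v v - dot u v ^+ 2) >= 0], which is conclusive once
   [dot v v] is positive. *)
have := dot_ge0 (dot v v *: u - dot u v *: v); rewrite !dotE (dotC v u) => H.
have [v0|v0] := eqVneq (dot v v) 0.
  have [->|d0] := eqVneq (dot u v) 0; first by rewrite v0 expr0n /= mulr0.
  (* this [t] would make [dot (u - t *: v) (u - t *: v) = -1] *)
  pose t := (dot u u + 1) / (2 * dot u v).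
  have E : t * dot u v = (dot u u + 1) / 2 by rewrite /t; field.
  have := dot_ge0 (u - t *: v); rewrite !dotE (dotC v u) v0; nra.
have {v0} : 0 < dot v v by rewrite lt_def v0 dot_ge0.
nra.
Qed.

Lemma dot_ge u v : - (l2norm u * l2norm v) <= dot u v.
Proof.
by rewrite lerNl; apply: le_trans (cauchy_schwarz u v); rewrite -normrN ler_norm.
Qed.

End euclidean_theory.

(** * Convergence of vectors *)

Section convergence.
Context {R : realType}.

Section filters.
Context {T : Type} {F : set_system T} {FF : Filter F}.

Lemma mx_cvg m n (u : T -> 'M[R]_(m, n)) (l : 'M[R]_(m, n)) :
  (forall i j, u t i j @[t --> F] --> l i j) -> u @ F --> l.
Proof.
move=> ul A [P Pl PA].
have H : \forall t \near F, forall ij, P ij.1 ij.2 (u t ij.1 ij.2).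
  by apply: filter_forall => -[i j]; exact: ul (Pl i j).
by apply: filterS H => t Ht; apply: PA => i j; exact: (Ht (i, j)).
Qed.

Lemma cvg_coord m n (u : T -> 'M[R]_(m, n)) (l : 'M[R]_(m, n)) i j :
  u @ F --> l -> u t i j @[t --> F] --> l i j.
Proof.
move=> ul; apply: (cvg_comp u (fun M : 'M[R]_(m, n) => M i j) ul).
exact: coord_continuous.
Qed.

Lemma cvg_sum m (u : 'I_m -> T -> R) (l : 'I_m -> R) :
  (forall i, u i @ F --> l i) -> \sum_i u i t @[t --> F] --> \sum_i l i.
Proof.
move=> ul; apply: (@cvg_big R _ +%R 0 xpredT _ T F _ u l FF (fun i _ => ul i)).
exact: add_continuous.
Qed.

Lemma cvg_dot m (u v : T -> 'cV[R]_m) (a b : 'cV[R]_m) :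
  u @ F --> a -> v @ F --> b -> dot (u t) (v t) @[t --> F] --> dot a b.
Proof. by move=> ua vb; apply: cvg_sum => i; apply: cvgM; exact: cvg_coord. Qed.

Lemma cvg_mulmx m n p (A : 'M[R]_(m, n)) (u : T -> 'M[R]_(n, p)) l :
  u @ F --> l -> A *m u t @[t --> F] --> A *m l.
Proof.
move=> ul; apply: mx_cvg => i j; rewrite mxE.
under eq_cvg do rewrite mxE.
by apply: cvg_sum => k; apply: cvgM; [exact: cvg_cst|exact: cvg_coord].
Qed.

Lemma cvg_l1norm m (u : T -> 'cV[R]_m) l :
  u @ F --> l -> l1norm (u t) @[t --> F] --> l1norm l.
Proof. by move=> ul; apply: cvg_sum => i; apply: cvg_norm; exact: cvg_coord. Qed.

Lemma cvg_hadamard m (u v : T -> 'cV[R]_m) (a b : 'cV[R]_m) :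
  u @ F --> a -> v @ F --> b -> hadamard (u t) (v t) @[t --> F] --> hadamard a b.
Proof.
move=> ua vb; apply: mx_cvg => i j; rewrite mxE.
under eq_cvg do rewrite mxE.
by apply: cvgM; exact: cvg_coord.
Qed.

Lemma l2norm_cvg0 m (u : T -> 'cV[R]_m) :
  l2norm (u t) @[t --> F] --> (0 : R) -> u @ F --> (0 : 'cV[R]_m).
Proof.
move=> /cvgrPdist_le u0; apply/cvgr0Pnorm_le => e e0.
near=> t; apply: le_trans (normr_le_l2norm _) _.
rewrite -[leLHS]ger0_norm ?l2norm_ge0// -normrN -sub0r.
by near: t; exact: u0.
Unshelve. all: by end_near. Qed.

Lemma sqr_cvg0 (u : T -> R) :
  u t ^+ 2 @[t --> F] --> (0 : R) -> u @ F --> (0 : R).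
Proof.
move=> /cvgr0Pnorm_le u0; apply/cvgr0Pnorm_le => e e0.
near=> t; rewrite -(@ler_pXn2r _ 2) ?nnegrE ?(ltW e0)// -normrX.
by near: t; apply: u0; rewrite exprn_gt0.
Unshelve. all: by end_near. Qed.

Lemma cvg_subK m n (u w : T -> 'M[R]_(m, n)) (a b : 'M[R]_(m, n)) :
  u t - w t @[t --> F] --> a -> w @ F --> b -> u @ F --> a + b.
Proof.
move=> ua wb; have -> : u = (fun t => u t - w t) + w.
  by apply/funext => t; rewrite !fctE subrK.
exact: cvgD.
Qed.

End filters.

Lemma cvg_l2norm_sub m T (F : set_system T) {FF : Filter F} (u : T -> 'cV[R]_m)
    (l : 'cV[R]_m) :
  u @ F --> l -> l2norm (u t - l) @[t --> F] --> (0 : R).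
Proof.
move=> ul; apply: sqr_cvg0; under eq_cvg do rewrite l2norm_sqr.
have ul0 : u t - l @[t --> F] --> (0 : 'cV[R]_m).
  by rewrite -(subrr l); apply: cvgB => //; exact: cvg_cst.
by have := cvg_dot ul0 ul0; rewrite dot0r; apply.
Qed.

Lemma increasing_seq_cvg (phi : nat -> nat) :
  increasing_seq phi -> phi @ \oo --> \oo.
Proof.
move=> phi_incr.
have phi_ge k : (k <= phi k)%N.
  elim: k => // k IH; apply: leq_ltn_trans IH _.
  by move/increasing_seqP: phi_incr => /(_ k).
move=> A [N _ NA]; exists N => // k /= Nk.
by apply: NA; exact: leq_trans Nk (phi_ge k).
Qed.

(** Induction over a list of coordinates: each new coordinate refines the subsequence found so far,
    and the limits already obtained survive the refinement. *)
Lemma bolzano_weierstrass_seq (I : eqType) (s : seq I) (w : I -> nat -> R) (M : R) :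
  (forall i k, `|w i k| <= M) ->
  exists2 phi : nat -> nat, increasing_seq phi &
    forall i, i \in s -> cvgn (w i \o phi).
Proof.
move=> wM; elim: s => [|i s [phi phi_incr cvg_phi]].
  by exists id.
have [|psi psi_incr cvg_psi] := @bolzano_weierstrass R (w i \o phi).
  exists M; split; first exact: num_real.
  by move=> c Mc k _ /=; apply: le_trans (wM _ _) (ltW Mc).
exists (phi \o psi) => [k l|j]; first exact: etrans (phi_incr _ _) (psi_incr _ _).
rewrite inE => /orP[/eqP->//|/cvg_phi cj].
apply/cvg_ex; exists (limn (w j \o phi)).
by apply: (@cvg_comp _ _ _ psi (w j \o phi) _ _ _ (increasing_seq_cvg psi_incr) cj).
Qed.

Lemma bolzano_weierstrass_cV m (u : nat -> 'cV[R]_m) (M : R) :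
  (forall k i, `|u k i 0| <= M) ->
  exists2 phi : nat -> nat, increasing_seq phi & cvgn (u \o phi).
Proof.
move=> uM.
have [//|phi phi_incr cphi] := @bolzano_weierstrass_seq _ (enum 'I_m)
  (fun i k => u k i 0) M.
exists phi => //; apply/cvg_ex.
exists (\col_i limn (fun k => u (phi k) i 0)).
apply: mx_cvg => i j; rewrite (ord1 j) mxE.
by apply: cphi; rewrite mem_enum.
Qed.

End convergence.

(** * Gradients *)

Section gradients.
Context {R : realType} {m : nat}.
Implicit Types (g h : 'cV[R]_m -> R) (x y v d : 'cV[R]_m).

Lemma diff_gradient g x d : differentiable g x -> 'd g x d = dot (gradient g x) d.
Proof.
move=> dg; have {1}-> : d = \sum_i d i 0 *: delta_mx i 0.
  by rewrite {1}[d]matrix_sum_delta; apply: eq_bigr => i _; rewrite big_ord1.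
rewrite linear_sum; apply: eq_bigr => i _.
by rewrite linearZ mxE deriveE// mulrC.
Qed.

Lemma gradient_expansion g x (e : R) : differentiable g x -> 0 < e ->
  \forall y \near x, `|g y - g x - dot (gradient g x) (y - x)| <= e * l2norm (y - x).
Proof.
move=> dg e0; have [[_ /eqaddoP]] := dg; move=> /(_ e e0).
rewrite norm_lim_id; apply: filterS => y /=.
rewrite !fctE opprD addrA diff_gradient// => /le_trans; apply.
by rewrite ler_pM2l// normr_le_l2norm.
Qed.

Lemma is_derive_line g x d (t : R) : differentiable g (x + t *: d) ->
  is_derive t 1 (fun s => g (x + s *: d)) (dot (gradient g (x + t *: d)) d).
Proof.
move=> dg.
have dl : is_diff t (fun s : R => x + s *: d) (fun s : R => s *: d).
  apply: (@is_diff_eq _ _ _ _ _ _ t (is_diffD (is_diff_cst x t) (is_diff_scalel t d))).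
  by apply/funext => s; rewrite !fctE add0r.
have dl0 := @ex_diff _ _ _ _ _ _ _ dl.
have dc := differentiable_comp dl0 dg.
split; first exact/derivable1_diffP.
by rewrite deriveE// (diff_comp dl0 dg) /= diff_val scale1r diff_gradient.
Qed.

Lemma dot_eq0 v : dot v v = 0 -> v = 0.
Proof.
rewrite -l2norm_sqr => /eqP; rewrite sqrf_eq0 => /eqP v0.
by apply/eqP; rewrite -normr_eq0 eq_le normr_ge0 andbT -v0 normr_le_l2norm.
Qed.

(** Along the line through [x] directed by the gradient [v] itself, the derivative at 0 is
    [dot v v], and it vanishes at a minimum. *)
Lemma gradient_argmin g x : (forall y, differentiable g y) ->
  (forall y, g x <= g y) -> gradient g x = 0.
Proof.
move=> dg gx; apply: dot_eq0; set v := gradient g x.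
have line t := is_derive_line (d := v) (dg (x + t *: v)).
have : is_derive (0 : R) 1 (fun s : R => g (x + s *: v)) 0.
  apply: (@derive1_at_min _ _ (-1) 1).
  - by rewrite (@le_trans _ _ 0)// lerN10.
  - by move=> t _; exact: ex_derive.
  - by rewrite in_itv/= ltr01 ltrN10.
  - by move=> t _; rewrite scale0r addr0.
move=> /(@derive_val _ _ _ _ _ _ _) <-.
by have /(@derive_val _ _ _ _ _ _ _) -> := line 0; rewrite scale0r addr0.
Qed.

(** The lower half of the descent lemma. The mean value theorem is applied to the gap [p] between
    [g] on the segment and the quadratic model [q]; by Cauchy-Schwarz and the Lipschitz bound, the
    derivative of [p] is nonnegative on the segment. *)
Lemma lipschitz_gradient_lower_bound (k : R) g x y :
  (forall z, differentiable g z) -> l2_lipschitz k (gradient g) ->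
  g x + dot (gradient g x) (y - x) - k / 2 * l2norm (y - x) ^+ 2 <= g y.
Proof.
move=> dg lipg; set d := y - x; set v := gradient g x.
pose q (t : R) := t * dot v d - k / 2 * dot d d * t ^+ 2.
pose dq (t : R) := dot v d - k * dot d d * t.
have q' (t : R) : is_derive t 1 q (dq t).
  apply: is_derive_eq; by rewrite /dq /GRing.scale/=; field.
pose p t := g (x + t *: d) - q t.
have p' (t : R) : is_derive t 1 p (dot (gradient g (x + t *: d)) d - dq t).
  by apply: is_deriveB; exact: is_derive_line.
have [|c c01] := MVT ltr01 (fun t _ => p' t).
  by apply: derivable_within_continuous => t _; exact: ex_derive.
rewrite /p /q scale0r addr0 scale1r /d [x + _]addrC subrK -/d subr0 mulr1.
rewrite l2norm_sqr mul0r mul1r expr1n mulr1 expr0n /= mulr0 subrr subr0 => E.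
suff : 0 <= dot (gradient g (x + c *: d)) d - dq c by lra.
have : dot (gradient g (x + c *: d) - v) d >= - (k * c * dot d d).
  have c0 : 0 <= c by move: c01; rewrite in_itv /= => /andP[/ltW].
  apply: le_trans (dot_ge _ _); rewrite lerN2 -l2norm_sqr expr2 mulrA.
  apply: ler_wpM2r; first exact: l2norm_ge0.
  have := lipg (x + c *: d) x; rewrite addrAC subrr add0r l2normZ ger0_norm//.
  by rewrite mulrA.
rewrite dotBl /dq; lra.
Qed.

(* A gradient step of size [(1 + k)^-1] upwards cannot exceed [M]. *)
Lemma gradient_bound (k M : R) g x : 0 <= k ->
  (forall z, differentiable g z) -> l2_lipschitz k (gradient g) ->
  (forall z, 0 <= g z <= M) ->
  l2norm (gradient g x) ^+ 2 <= 2 * M * (1 + k).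
Proof.
move=> k0 dg lipg gM; set v := gradient g x.
have := lipschitz_gradient_lower_bound x (x + (1 + k)^-1 *: v) dg lipg.
rewrite [x + _ - x]addrAC subrr add0r -/v l2norm_sqr !dotE.
have /andP[_] := gM (x + (1 + k)^-1 *: v); have /andP[] := gM x.
set t := (1 + k)^-1; set D := dot v v.
move: (g x) (g _) => a b a0 _ bM H.
(* The step [(1 + k)^-1], unlike [k^-1], also makes sense for [k = 0], and [k * t <= 1] makes the
   factor [1 - k * t / 2] below at least 1/2. *)
have t1 : (1 + k) * t = 1 by rewrite mulfV//; lra.
have t0 : 0 < t by rewrite invr_gt0; lra.
have D0 : 0 <= D := dot_ge0 v.
have H1 : t * D * (1 - k * t / 2) <= M by lra.
have H2 : t * D / 2 <= M.
  apply: le_trans H1; rewrite ler_wpM2l// ?mulr_ge0 ?(ltW t0)//.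
  nra.
rewrite l2norm_sqr -/D; have -> : D = 2 * (1 + k) * (t * D / 2).
  by have : (1 + k) * t * D = D; [rewrite t1 mul1r|nra].
rewrite [leRHS]mulrAC ler_wpM2l//; lra.
Qed.

End gradients.

(** * Gradients of sums, affine functions and squared distances *)

Section gradient_rules.
Context {R : realType} {m : nat}.
Implicit Types (g h : 'cV[R]_m -> R) (x y v : 'cV[R]_m).

Lemma dot_delta v i : dot v (delta_mx i 0) = v i 0.
Proof.
rewrite /dot (bigD1 i)//= big1 ?addr0 ?mxE ?eqxx ?mulr1// => j ji.
by rewrite mxE (negbTE ji) mulr0.
Qed.

(** A quadratic remainder is a little-o, so [dot v] is the differential by uniqueness. Affine
    functions and squared distances have explicit remainders of this kind. *)
Lemma has_gradient_quadratic_remainder (C : R) g x v :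
  (forall y, `|g y - g x - dot v (y - x)| <= C * l2norm (y - x) ^+ 2) ->
  has_gradient g x v.
Proof.
move=> gxv.
have lin_v : linear (dot v) by move=> c a b; rewrite dotDr dotZr.
pose vM := GRing.isLinear.Build _ _ _ _ (dot v) lin_v.
pose vL : {linear 'cV[R]_m -> R} := HB.pack (dot v) vM.
have cont_v : continuous vL.
  by move=> y; apply: (cvg_dot (cvg_cst v) (@cvg_id _ (nbhs y))).
suff expand : g \o shift x = cst (g x) + (vL : 'cV[R]_m -> R^o)
    +o_ (0 : 'cV[R]_m) (@id 'cV[R]_m).
  have dgE := diff_unique cont_v expand.
  have dg : differentiable g x by apply/diff_locallyP; rewrite dgE.
  split=> //; apply/matrixP => i j; rewrite (ord1 j) mxE deriveE// dgE.
  exact: dot_delta.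
apply/eqaddoP => e e0.
(* The factor [m ^ 2] pays for passing from [l2norm] to the sup norm; the added 1 keeps [D]
   positive. *)
pose D := `|C| * m%:R ^+ 2 + 1.
have D0 : 0 < D by rewrite ltr_wpDl// mulr_ge0// exprn_ge0.
near=> y.
have yD : `|y| <= e / D.
  by near: y; apply: (@nbhs0_le _ 'cV[R]_m); exact: divr_gt0.
rewrite !fctE opprD addrA; have := gxv (y + x); rewrite addrK => /le_trans; apply.
apply: (@le_trans _ _ (D * `|y| * `|y|)); last first.
  by rewrite ler_wpM2r// mulrC -ler_pdivlMr.
apply: (@le_trans _ _ (`|C| * (m%:R * `|y|) ^+ 2)).
  apply: (@le_trans _ _ (`|C| * l2norm y ^+ 2)).
    by rewrite ler_wpM2r ?sqr_ge0 ?ler_norm.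
  by rewrite ler_wpM2l// ler_pXn2r ?nnegrE ?mulr_ge0 ?l2norm_ge0 ?l2norm_le_normr.
by rewrite exprMn mulrA -[leRHS]mulrA -expr2 ler_wpM2r ?sqr_ge0// lerDl.
Unshelve. all: by end_near. Qed.

Lemma has_gradientD g h x u v :
  has_gradient g x u -> has_gradient h x v -> has_gradient (g + h) x (u + v).
Proof.
move=> [dg <-] [dh <-]; split; first exact: differentiableD.
by apply/matrixP => i j; rewrite !mxE deriveD//; exact: diff_derivable.
Qed.

Lemma has_gradient_affine c (v : 'cV[R]_m) w x :
  has_gradient (fun y => c + dot v (y - w)) x v.
Proof.
apply: (has_gradient_quadratic_remainder (C := 0)) => y.
rewrite mul0r normr_le0 !dotE; apply/eqP; ring.
Qed.

Lemma has_gradient_l2norm_sqr (c : R) w x :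
  has_gradient (fun y => c / 2 * l2norm (y - w) ^+ 2) x (c *: (x - w)).
Proof.
apply: (has_gradient_quadratic_remainder (C := `|c / 2|)) => y.
suff -> : c / 2 * l2norm (y - w) ^+ 2 - c / 2 * l2norm (x - w) ^+ 2
    - dot (c *: (x - w)) (y - x) = c / 2 * l2norm (y - x) ^+ 2.
  by rewrite normrM [`|_ ^+ 2|]ger0_norm ?sqr_ge0.
by rewrite !l2norm_sqr !dotE (dotC w y) (dotC x y) (dotC w x); field.
Qed.

End gradient_rules.

(** * Stationary points of the augmented Lagrangian *)

Section subdifferentials.
Context {R : realType} {m : nat}.
Implicit Types (F : 'cV[R]_m -> \bar R) (x v : 'cV[R]_m).

(** Constant sequences witness the limit, so the stationarity inclusions reduce to regular
    subgradients. *)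
Lemma regular_subdiff_limiting F x v :
  regular_subdiff F x v -> limiting_subdiff F x v.
Proof.
move=> Fxv; split; first by case: Fxv.
by exists (fun=> x), (fun=> v); split=> //; exact: cvg_cst.
Qed.

Lemma argmin_regular_subdiff F x :
  argmin F x -> F x \is a fin_num -> regular_subdiff F x 0.
Proof.
move=> Fx finx; split=> // e e0; apply: (@nearW _ (nbhs x)) => y; apply: le_trans (Fx y).
rewrite -[leRHS]adde0; apply: leeD2l; rewrite lee_fin dotC dot0r sub0r oppr_le0.
by rewrite mulr_ge0 ?l2norm_ge0// ltW.
Qed.

End subdifferentials.

(** * Blocks of a stacked vector *)

Section blocks.
Context {R : realType} {p q : nat}.
Implicit Types z : 'cV[R]_(p + q).

Lemma dot_blocks z : dot z z = dot (usubmx z) (usubmx z) + dot (dsubmx z) (dsubmx z).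
Proof.
by rewrite {1}/dot big_split_ord; congr (_ + _); apply: eq_bigr => i _; rewrite mxE.
Qed.

Lemma l2norm_usubmx z : l2norm (usubmx z) <= l2norm z.
Proof.
rewrite -(@ler_pXn2r _ 2) ?nnegrE ?l2norm_ge0// !l2norm_sqr dot_blocks lerDl.
exact: dot_ge0.
Qed.

Lemma l2norm_dsubmx z : l2norm (dsubmx z) <= l2norm z.
Proof.
rewrite -(@ler_pXn2r _ 2) ?nnegrE ?l2norm_ge0// !l2norm_sqr dot_blocks lerDr.
exact: dot_ge0.
Qed.

Lemma usubmx_continuous : continuous (usubmx : 'cV[R]_(p + q) -> 'cV[R]_p).
Proof.
move=> z; apply: (@mx_cvg R _ (nbhs z)) => i j; rewrite mxE.
under eq_cvg do rewrite mxE.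
exact: coord_continuous.
Qed.

Lemma dsubmx_continuous : continuous (dsubmx : 'cV[R]_(p + q) -> 'cV[R]_q).
Proof.
move=> z; apply: (@mx_cvg R _ (nbhs z)) => i j; rewrite mxE.
under eq_cvg do rewrite mxE.
exact: coord_continuous.
Qed.

End blocks.

(** * The Lagrangian for a function that is real on [K] and infinite elsewhere *)

Section lagrangian.
Context {R : realType} {m : nat}.
Context {f : 'cV[R]_m -> \bar R} {g : 'cV[R]_m -> R} {K : set 'cV[R]_m}.
Context {h : 'cV[R]_m -> R} {H : 'M[R]_m} {rho : R}.
Implicit Types U V P W : 'cV[R]_m.

Context (fK : forall U, K U -> f U = (g U)%:E).
Context (fNK : forall U, ~ K U -> f U = +oo%E).
Context (dh : forall V, differentiable h V).
Context (rho0 : 0 < rho).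

(** The part of the Lagrangian that is finite everywhere, kept real-valued so that ring arithmetic
    applies. *)
Definition coupling U V P : R :=
  h V + dot P (V - H *m U) + rho / 2 * l2norm (V - H *m U) ^+ 2.

Local Notation L := (aug_lagrangian f h H rho).

Lemma aug_lagrangianK U V P : K U -> L U V P = (g U + coupling U V P)%:E.
Proof. by move=> KU; rewrite /aug_lagrangian fK. Qed.

Lemma aug_lagrangianNK U V P : ~ K U -> L U V P = +oo%E.
Proof. by move=> KU; rewrite /aug_lagrangian fNK. Qed.

(** A point of [K] has a finite value, which excludes minimizers outside [K]; the U-step becomes a
    real minimization over [K]. *)
Lemma argmin_lagrangianU U V P : K !=set0 ->
  argmin (fun W => L W V P) U <->
  K U /\ forall W, K W -> g U + coupling U V P <= g W + coupling W V P.
Proof.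
move=> [W0 KW0]; split=> [Umin|[KU Umin] W].
  have KU : K U.
    apply: contrapT => /aug_lagrangianNK UNK.
    by have := Umin W0; rewrite UNK aug_lagrangianK.
  split=> // W KW.
  by have := Umin W; rewrite !aug_lagrangianK.
have [KW|NKW] := pselect (K W); last by rewrite (aug_lagrangianNK _ _ NKW) leey.
by rewrite !aug_lagrangianK// lee_fin Umin.
Qed.

Lemma has_gradient_lagrangianV U V P : K U ->
  has_gradient (fun W => fine (L U W P)) V (gradient h V + P + rho *: (V - H *m U)).
Proof.
move=> KU.
have -> : (fun W => fine (L U W P)) = h + (fun W => g U + dot P (W - H *m U))
    + (fun W => rho / 2 * l2norm (W - H *m U) ^+ 2).
  by apply/funext => W; rewrite aug_lagrangianK//= /coupling !fctE; ring.
apply: has_gradientD; last exact: has_gradient_l2norm_sqr.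
by apply: has_gradientD; [split|exact: has_gradient_affine].
Qed.

Lemma has_gradient_lagrangianP U V P : K U ->
  has_gradient (fun W => fine (L U V W)) P (V - H *m U).
Proof.
move=> KU; set w := V - H *m U.
have -> : (fun W => fine (L U V W)) =
    (fun W => (g U + h V + rho / 2 * l2norm w ^+ 2) + dot w (W - 0)).
  apply/funext => W; rewrite aug_lagrangianK//= /coupling -/w subr0 (dotC w); ring.
exact: has_gradient_affine.
Qed.

Lemma argmin_lagrangianV U V P : K U ->
  argmin (fun W => L U W P) V -> gradient h V + P + rho *: (V - H *m U) = 0.
Proof.
move=> KU Vmin; have [_ <-] := has_gradient_lagrangianV V P KU.
apply: gradient_argmin => W; first by have [] := has_gradient_lagrangianV W P KU.
by have := Vmin W; rewrite !aug_lagrangianK.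
Qed.

(* At a feasible point with [gradient h Vs = - Ps], moving [(V, P)] changes the
   Lagrangian by [dot (P - Ps) (V - H U)] up to [o(|V - Vs|)], which is of higher
   order since [V - H U] tends to [Vs - H Us = 0]. *)
Lemma stationary_lagrangian Us Vs Ps : K !=set0 ->
  argmin (fun W => L W Vs Ps) Us -> Vs = H *m Us -> gradient h Vs = - Ps ->
  stationary L Us Vs Ps.
Proof.
move=> K0 Umin VsE gVs; have [KUs _] := (argmin_lagrangianU _ _ _ K0).1 Umin.
split; last 2 first.
- have := has_gradient_lagrangianV Vs Ps KUs.
  by rewrite gVs addNr add0r -VsE subrr scaler0.
- by have := has_gradient_lagrangianP Vs Ps KUs; rewrite {2}VsE subrr.
- apply: regular_subdiff_limiting; split.
    by rewrite /uncurry3 !(col_mxKu, col_mxKd) aug_lagrangianK.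
  move=> e e0; set z0 := col_mx _ _.
  (* With [n] the distance to [z0], the errors will be [e / 2 * n] from [h], [c1 * n] and
     [rho * c1 * n] from the two products with the residual, and [rho / 2 * c2 * n] from the square.
     These radii make the total exactly [e * n]. *)
  pose c1 := e / 4 / (1 + rho); pose c2 := e / 2 / rho.
  have c10 : 0 < c1 by rewrite !divr_gt0// ltr_wpDr// ltW.
  have c20 : 0 < c2 by rewrite !divr_gt0.
  pose VZ (z : 'cV[R]_(m + (m + m))) := usubmx (dsubmx z).
  have cvgU : usubmx z @[z --> z0] --> Us.
    by have := @usubmx_continuous R _ _ z0; rewrite /z0 /continuous_at col_mxKu.
  have cvgV : VZ z @[z --> z0] --> Vs.
    have := cvg_comp _ _ (@dsubmx_continuous R _ _ z0) (@usubmx_continuous R _ _ _).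
    by rewrite /z0 col_mxKd col_mxKu.
  have nearh : \forall z \near z0,
      `|h (VZ z) - h Vs - dot (gradient h Vs) (VZ z - Vs)| <= e / 2 * l2norm (VZ z - Vs).
    by have := cvgV _ (gradient_expansion (dh Vs) (divr_gt0 e0 (ltr0n R 2))).
  have cvgA : VZ z - H *m usubmx z @[z --> z0] --> (0 : 'cV[R]_m).
    have -> : (0 : 'cV[R]_m) = Vs - H *m Us by rewrite VsE subrr.
    exact: (cvgB cvgV (cvg_mulmx (A := H) cvgU)).
  have nearA : \forall z \near z0, l2norm (VZ z - H *m usubmx z) <= c1.
    by apply: filterS (cvgr_le 0 (cvg_l2norm_sub cvgA) _ c10) => z; rewrite subr0.
  have nearV : \forall z \near z0, l2norm (VZ z - Vs) <= c2.
    exact: cvgr_le 0 (cvg_l2norm_sub cvgV) _ c20.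
  apply: filterS3 nearh nearA nearV => z.
  have bz : l2norm (VZ z - Vs) <= l2norm (z - z0).
    apply: le_trans (l2norm_dsubmx _); apply: le_trans (l2norm_usubmx _).
    by rewrite !linearB /= !(col_mxKd, col_mxKu).
  have pz : l2norm (dsubmx (dsubmx z) - Ps) <= l2norm (z - z0).
    apply: le_trans (l2norm_dsubmx _); apply: le_trans (l2norm_dsubmx _).
    by rewrite !linearB /= !(col_mxKd, col_mxKu).
  rewrite /uncurry3 !(col_mxKd, col_mxKu) -/(VZ z).
  move: bz pz; move: (usubmx z) (VZ z) (dsubmx (dsubmx z)) => U V P bz pz hV A1 b2.
  set n := l2norm (z - z0) in bz pz *.
  have n0 : 0 <= n := l2norm_ge0 _.
  have [KU|NKU] := pselect (K U); last by rewrite (aug_lagrangianNK _ _ NKU) leey.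
  rewrite !aug_lagrangianK// -EFinD lee_fin dotC dot0r sub0r.
  (* Minimality of [Us] handles the change in [U] at fixed [(Vs, Ps)]; only the change from
     [(Vs, Ps)] to [(V, P)] at fixed [U] remains. *)
  have [_ /(_ U KU)] := (argmin_lagrangianU _ _ _ K0).1 Umin.
  pose b := V - Vs; pose p := P - Ps; pose A := V - H *m U.
  have couplingB : coupling U V P - coupling U Vs Ps =
      (h V - h Vs + dot Ps b) + dot p A + rho * dot A b - rho / 2 * l2norm b ^+ 2.
    have AbE : A - b = Vs - H *m U by rewrite /A /b opprB addrC addrA subrK.
    have PE : P = Ps + p by rewrite addrC subrK.
    rewrite /coupling -AbE -/A PE; clearbody A b p.
    by rewrite !l2norm_sqr !dotE (dotC b A); field.
  (* Since [gradient h Vs = - Ps], the term [dot Ps b] cancels the linear part of [h]. *)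
  have h_ge : - (e / 2 * n) <= h V - h Vs + dot Ps b.
    move: hV; rewrite gVs dotNl opprK ler_norml => /andP[+ _]; apply: le_trans.
    by rewrite lerN2 ler_wpM2l// divr_ge0// ltW.
  have pA_ge : - (n * c1) <= dot p A.
    by apply: le_trans (dot_ge _ _); rewrite lerN2 ler_pM ?l2norm_ge0.
  have Ab_ge : - (c1 * n) <= dot A b.
    by apply: le_trans (dot_ge _ _); rewrite lerN2 ler_pM ?l2norm_ge0.
  have b_le : l2norm b ^+ 2 <= n * c2 by rewrite expr2 ler_pM ?l2norm_ge0.
  have c1E : c1 * (1 + rho) = e / 4 by rewrite divfK// gt_eqF// ltr_wpDr// ltW.
  have c2E : c2 * rho = e / 2 by rewrite divfK// gt_eqF.
  have rAb_ge : rho * - (c1 * n) <= rho * dot A b by rewrite ler_pM2l.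
  have rb_le : rho / 2 * l2norm b ^+ 2 <= rho / 2 * (n * c2).
    by rewrite ler_pM2l// divr_gt0.
  have En : n * (c1 * (1 + rho)) = n * (e / 4) by rewrite c1E.
  have En2 : n * (c2 * rho) = n * (e / 2) by rewrite c2E.
  lra.
- apply: regular_subdiff_limiting; apply: argmin_regular_subdiff => //.
  by rewrite aug_lagrangianK.
Qed.

End lagrangian.

(** * Convergence of ADMM *)

Section admm_convergence.
Context {R : realType} {m : nat}.
Context {f : 'cV[R]_m -> \bar R} {g : 'cV[R]_m -> R} {K : set 'cV[R]_m}.
Context {h : 'cV[R]_m -> R} {H : 'M[R]_m} {rho : R} {k M : R}.
Context (fK : forall U, K U -> f U = (g U)%:E).
Context (fNK : forall U, ~ K U -> f U = +oo%E).
Context (dh : forall V, differentiable h V).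
Context (rho0 : 0 < rho).
Context (K0 : K !=set0) (g_ge0 : forall U, K U -> 0 <= g U).
Context (h_bnd : forall V, 0 <= h V <= M).
Context (k0 : 0 <= k) (k_rho : 2 * k < rho)
  (lip_h : l2_lipschitz k (gradient h)).
Implicit Types U V P W : 'cV[R]_m.

Local Notation L := (aug_lagrangian f h H rho).
Local Notation S := (@coupling R m h H rho).

Definition descent_rate : R := (rho - k) / 2 - k ^+ 2 / rho.

(** The rate factors with [rho - 2 * k] as the only factor whose sign is in question. *)
Lemma descent_rate_gt0 : 0 < descent_rate.
Proof.
have -> : descent_rate = (rho - 2 * k) * (rho + k) / (2 * rho).
  by rewrite /descent_rate; field; rewrite gt_eqF.
by rewrite divr_gt0 ?mulr_gt0 ?subr_gt0// ltr_wpDr.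
Qed.

(** The U-step does not increase the Lagrangian; [HB] measures the gain of the V-step and [HA] the
    cost of the dual step. *)
Lemma lagrangian_descent U V P U' V' P' :
  K U -> P = - gradient h V ->
  argmin (fun W => L W V P) U' -> argmin (fun W => L U' W P) V' ->
  P' = P + rho *: (V' - H *m U') ->
  g U' + S U' V' P' + descent_rate * l2norm (V' - V) ^+ 2 <= g U + S U V P.
Proof.
move=> KU PE /(argmin_lagrangianU fK fNK _ _ _ K0) [KU' Umin] Vmin P'E.
have P'grad : P' = - gradient h V'.
  have := argmin_lagrangianV fK dh KU' Vmin.
  by rewrite -addrA -P'E addrC => /eqP; rewrite addr_eq0 => /eqP.
apply: le_trans (Umin _ KU).
(* The expansion is centred at the new point [V'], where the gradient is minus the new multiplier
   [P']. *)
have gV' := lipschitz_gradient_lower_bound V' V dh lip_h.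
have dP : l2norm (P' - P) ^+ 2 <= k ^+ 2 * l2norm (V' - V) ^+ 2.
  rewrite -exprMn ler_pXn2r ?nnegrE ?mulr_ge0 ?l2norm_ge0//.
  by rewrite PE P'grad -opprD l2normN; exact: lip_h.
have -> : g U' + S U' V P = g U' + S U' V' P' + (S U' V P - S U' V' P)
   - (S U' V' P' - S U' V' P) by ring.
have HA : S U' V' P' - S U' V' P = rho^-1 * l2norm (P' - P) ^+ 2.
  have -> : S U' V' P' - S U' V' P = dot (P' - P) (V' - H *m U').
    by rewrite dotBl /coupling; ring.
  have -> : P' - P = rho *: (V' - H *m U') by rewrite P'E addrAC subrr add0r.
  by rewrite l2norm_sqr !dotZl !dotZr; field; exact: lt0r_neq0.
have HB : S U' V P - S U' V' P >= (rho - k) / 2 * l2norm (V' - V) ^+ 2.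
  have {}gV' : h V' - dot P' (V - V') - k / 2 * l2norm (V - V') ^+ 2 <= h V.
    by move: gV'; rewrite P'grad dotNl opprK.
  rewrite -(opprB V V') l2normN.
  pose d := V - V'; pose A := V' - H *m U'.
  (* As [P' = P + rho *: A], the linear terms [dot P d + rho * dot A d] add up to [dot P' d], which
     cancels the one in [gV'] and leaves [(rho - k) / 2] times the square of [d]. *)
  have dA : V - H *m U' = A + d by rewrite /A /d [RHS]addrC addrA subrK.
  rewrite /coupling dA; move: gV'; rewrite -/d -/A P'E -/A.
  clearbody d A; rewrite !l2norm_sqr !dotE (dotC d A); lra.
rewrite HA /descent_rate.
have : rho^-1 * l2norm (P' - P) ^+ 2 <= k ^+ 2 / rho * l2norm (V' - V) ^+ 2.
  by rewrite [k ^+ 2 / rho]mulrC -mulrA ler_pM2l ?invr_gt0.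
lra.
Qed.

(** Completing the square bounds the terms in the residual below by [- l2norm P ^+ 2 / (2 * rho)],
    and [gradient_bound] controls [P]. *)
Lemma lagrangian_ge U V P : K U -> P = - gradient h V ->
  - (M * (1 + k) / rho) <= g U + S U V P.
Proof.
move=> KU PE.
have := gradient_bound V k0 dh lip_h h_bnd.
rewrite -l2normN -PE /coupling => P_le.
have gU := g_ge0 KU; have /andP[hV _] := h_bnd V.
move: (V - H *m U) => A.
suff : - (M * (1 + k) / rho) <= dot P A + rho / 2 * l2norm A ^+ 2 by lra.
have := dot_ge0 (P + rho *: A); rewrite !dotE (dotC A P).
move: P_le; rewrite !l2norm_sqr => P_le Q.
rewrite -(@ler_pM2l _ (2 * rho)) ?mulr_gt0//.
have -> : 2 * rho * - (M * (1 + k) / rho) = - (2 * M * (1 + k)).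
  by field; exact: lt0r_neq0.
lra.
Qed.

Context (closedK : closed K) (cont_g : continuous g).
Context {B : R} (boundedK : forall U i, K U -> `|U i 0| <= B).

(** The initial data are arbitrary, so feasibility and the multiplier identity are only available
    from index 1 on. *)
Lemma admm_iterates (U V P : nat -> 'cV[R]_m) : admm L H rho U V P ->
  forall j, K (U j.+1) /\ P j.+1 = - gradient h (V j.+1).
Proof.
move=> run j; have [Umin Vmin P'E] := run j.
have [KU' _] := (argmin_lagrangianU fK fNK _ _ _ K0).1 Umin; split=> //.
have := argmin_lagrangianV fK dh KU' Vmin.
by rewrite -addrA -P'E addrC => /eqP; rewrite addr_eq0 => /eqP.
Qed.

Lemma lipschitz_gradient_cvg T (F : set_system T) {FF : Filter F}
    (v : T -> 'cV[R]_m) l :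
  v @ F --> l -> gradient h (v t) @[t --> F] --> gradient h l.
Proof.
move=> vl.
have kv : k * l2norm (v t - l) @[t --> F] --> (0 : R).
  by rewrite -(mulr0 k); apply: cvgM; [exact: cvg_cst|exact: cvg_l2norm_sub].
have d0 : gradient h (v t) - gradient h l @[t --> F] --> (0 : 'cV[R]_m).
  apply: l2norm_cvg0; apply: squeeze_cvgr (cvg_cst 0) kv.
  by apply: nearW => t; rewrite l2norm_ge0 lip_h.
by have := cvg_subK d0 (cvg_cst (gradient h l)); rewrite add0r; apply.
Qed.

(** The Lagrangian values [r] decrease and are bounded below, so their consecutive differences tend
    to 0 and dominate the squared V-steps. The residual is the dual step divided by [rho], hence at
    most [k / rho] times the V-step. *)
Lemma admm_residuals (U V P : nat -> 'cV[R]_m) : admm L H rho U V P ->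
  (forall j, K (U j)) -> (forall j, P j = - gradient h (V j)) ->
  V j.+1 - V j @[j --> \oo] --> (0 : 'cV[R]_m) /\
  V j.+1 - H *m U j.+1 @[j --> \oo] --> (0 : 'cV[R]_m).
Proof.
move=> run KU PE.
pose r j := g (U j) + S (U j) (V j) (P j).
have r_descent j : r j.+1 + descent_rate * l2norm (V j.+1 - V j) ^+ 2 <= r j.
  by have [] := run j; exact: lagrangian_descent.
have c0 := descent_rate_gt0.
have r_noninc : nonincreasing_seq r.
  apply/nonincreasing_seqP => j; apply: le_trans (r_descent j).
  by rewrite lerDl mulr_ge0 ?sqr_ge0 ?(ltW c0).
have cvg_r : cvgn r.
  apply: nonincreasing_is_cvgn => //; exists (- (M * (1 + k) / rho)) => _ [j _ <-].
  exact: lagrangian_ge.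
have dr0 : (r j - r j.+1) / descent_rate @[j --> \oo] --> (0 : R).
  rewrite -(mul0r descent_rate^-1) -(subrr (limn r)).
  apply: cvgM; last exact: cvg_cst.
  by apply: cvgB => //; rewrite (cvg_shiftS r).
have dV0 : l2norm (V j.+1 - V j) @[j --> \oo] --> (0 : R).
  apply: sqr_cvg0; apply: squeeze_cvgr (cvg_cst 0) dr0.
  apply: nearW => j; rewrite sqr_ge0/= ler_pdivlMr// mulrC.
  have := r_descent j; lra.
split; first exact: l2norm_cvg0.
apply: l2norm_cvg0.
have kdV0 : k / rho * l2norm (V j.+1 - V j) @[j --> \oo] --> (0 : R).
  by rewrite -(mulr0 (k / rho)); apply: cvgM => //; exact: cvg_cst.
apply: squeeze_cvgr (cvg_cst 0) kdV0; apply: nearW => j; rewrite l2norm_ge0/=.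
have [_ _ P'E] := run j.
have -> : V j.+1 - H *m U j.+1 = rho^-1 *: (P j.+1 - P j).
  by rewrite P'E addrAC subrr add0r scalerA mulVf ?scale1r// gt_eqF.
rewrite l2normZ ger0_norm ?invr_ge0 ?(ltW rho0)// mulrAC mulrC.
rewrite ler_pM2r ?invr_gt0// !PE -opprD l2normN; exact: lip_h.
Qed.

Lemma admm_subsequence (U V P : nat -> 'cV[R]_m) : admm L H rho U V P ->
  (forall j, K (U j)) -> (forall j, P j = - gradient h (V j)) ->
  exists (phi : nat -> nat) (Us Vs Ps : 'cV[R]_m),
    [/\ increasing_seq phi,
        U (phi j).+1 @[j --> \oo] --> Us,
        V (phi j).+1 @[j --> \oo] --> Vs,
        P (phi j).+1 @[j --> \oo] --> Ps &
        stationary L Us Vs Ps].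
Proof.
move=> run KU PE; have [dV0 A0] := admm_residuals run KU PE.
have [phi phi_incr /cvg_ex[/= Us cvgU]] :=
  bolzano_weierstrass_cV (u := fun j => U j.+1) (fun j i => boundedK i (KU _)).
have phioo := increasing_seq_cvg phi_incr.
have {}dV0 := cvg_comp _ _ phioo dV0.
have {}A0 := cvg_comp _ _ phioo A0.
pose Vs := H *m Us; pose Ps := - gradient h Vs.
have cvgV' : V (phi j).+1 @[j --> \oo] --> Vs.
  by have := cvg_subK A0 (cvg_mulmx (A := H) cvgU); rewrite add0r; apply.
(* The iterate [U (phi j).+1] minimizes the Lagrangian at [V (phi j)] and [P (phi j)], so the limits
   at the unshifted indices are needed too; vanishing V-steps supply them. *)
have cvgV : V (phi j) @[j --> \oo] --> Vs.
  have dV0N : V (phi j) - V (phi j).+1 @[j --> \oo] --> (0 : 'cV[R]_m).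
    rewrite -oppr0; under eq_cvg do rewrite -opprB.
    exact: cvgN.
  by have := cvg_subK dV0N cvgV'; rewrite add0r; apply.
have cvgP' : P (phi j).+1 @[j --> \oo] --> Ps.
  under eq_cvg do rewrite PE.
  by apply: cvgN; exact: lipschitz_gradient_cvg.
have cvgP : P (phi j) @[j --> \oo] --> Ps.
  under eq_cvg do rewrite PE.
  by apply: cvgN; exact: lipschitz_gradient_cvg.
exists phi, Us, Vs, Ps; split=> //.
apply: (stationary_lagrangian fK fNK dh rho0 K0); rewrite ?opprK//.
have KUs : K Us by apply: (closed_cvg K closedK _ Us cvgU); apply: nearW => j; exact: KU.
apply/(argmin_lagrangianU fK fNK _ _ _ K0); split=> // W KW.
(* Used twice, for the minimizers [U (phi j).+1] and for a constant competitor [W]; the U-step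
   inequality then passes to the limit. *)
have cvgS (w : nat -> 'cV[R]_m) (ws : 'cV[R]_m) : w @ \oo --> ws ->
    g (w j) + S (w j) (V (phi j)) (P (phi j)) @[j --> \oo] --> g ws + S ws Vs Ps.
  move=> cvgw.
  have cvgA : V (phi j) - H *m w j @[j --> \oo] --> Vs - H *m ws.
    by apply: cvgB => //; exact: cvg_mulmx.
  rewrite /coupling l2norm_sqr; under eq_cvg do rewrite l2norm_sqr.
  apply: cvgD; first exact: (cvg_comp w g cvgw (@cont_g ws)).
  apply: cvgD; last by apply: cvgM; [exact: cvg_cst|exact: cvg_dot].
  apply: cvgD; last exact: cvg_dot.
  exact: (cvg_comp _ h cvgV (differentiable_continuous (dh Vs))).
apply: (ler_cvg_to (cvgS _ _ cvgU) (cvgS _ _ (cvg_cst W))).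
apply: nearW => j; have [Umin _ _] := run (phi j).
by have [_] := (argmin_lagrangianU fK fNK _ _ _ K0).1 Umin; exact.
Qed.

Theorem admm_stationary_subsequence (U V P : nat -> 'cV[R]_m) : admm L H rho U V P ->
  exists (phi : nat -> nat) (Us Vs Ps : 'cV[R]_m),
    [/\ increasing_seq phi,
        U (phi j) @[j --> \oo] --> Us,
        V (phi j) @[j --> \oo] --> Vs,
        P (phi j) @[j --> \oo] --> Ps &
        stationary L Us Vs Ps].
Proof.
move=> run; have reg := admm_iterates run.
have [phi [Us [Vs [Ps [phi_incr ? ? ? ?]]]]] :=
  @admm_subsequence (fun j => U j.+1) (fun j => V j.+1) (fun j => P j.+1)
    (fun j => run j.+1) (fun j => (reg j).1) (fun j => (reg j).2).
(* One shift drops the initial data, the other comes from the indices [(phi j).+1] in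
   [admm_subsequence]. *)
exists (fun j => (phi j).+2), Us, Vs, Ps; by split.
Qed.

End admm_convergence.

(** * The fidelity and regularization terms *)

Section fidelity_theory.
Context {R : realType} {N : nat} {a tr : R} {I : 'cV[R]_N}.
Implicit Types V : 'cV[R]_N.

Lemma sigmoid_gt0 (t : R) : 0 < sigmoid a tr t.
Proof. by rewrite invr_gt0 addr_gt0 ?expR_gt0. Qed.

Lemma sigmoid_lt1 (t : R) : sigmoid a tr t < 1.
Proof. by rewrite invf_lt1 ?ltrDl ?addr_gt0 ?expR_gt0. Qed.

(** A sum of functions of one coordinate each, so differentiability and bounds can be checked
    termwise; the modulus disappears in the real square. *)
Lemma fidelityE : fidelity a tr I =
  \sum_i (fun V => (sigmoid a tr (V i 0 ^+ 2) - I i 0) ^+ 2).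
Proof.
apply/funext => V; rewrite /fidelity l2norm_sqr fct_sumE.
by apply: eq_bigr => i _; rewrite !mxE real_normK ?num_real// expr2.
Qed.

Lemma fidelity_differentiable V : differentiable (fidelity a tr I) V.
Proof.
rewrite fidelityE; apply: differentiable_sum => i.
have dV : differentiable (fun W : 'cV[R]_N => W i 0) V by exact: differentiable_coord.
have dexp : differentiable (fun W : 'cV[R]_N => 1 + expR (- a * (W i 0 ^+ 2 - tr))) V.
  apply: differentiableD => //.
  apply: (@differentiable_comp _ _ _ _
    (fun W : 'cV[R]_N => - a * (W i 0 ^+ 2 - tr)) expR).
    apply: differentiableM => //; apply: differentiableB => //.
    exact: (differentiableM dV dV).
  by apply/derivable1_diffP; exact: derivable_expR.
have dsig : differentiable (fun W : 'cV[R]_N => sigmoid a tr (W i 0 ^+ 2) - I i 0) V.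
  apply: differentiableB => //.
  by apply: differentiableV => //; rewrite gt_eqF// addr_gt0 ?expR_gt0.
exact: (differentiableM dsig dsig).
Qed.

(** Sigmoid values lie strictly between 0 and 1 and the target is binary, so each squared gap is at
    most 1. *)
Lemma fidelity_bounds V : (forall i, I i 0 = 0 \/ I i 0 = 1) ->
  0 <= fidelity a tr I V <= N%:R.
Proof.
move=> I01; rewrite fidelityE fct_sumE sumr_ge0/=; last by move=> i _; rewrite sqr_ge0.
have -> : N%:R = \sum_(i < N) (1 : R) by rewrite sumr_const card_ord.
apply: ler_sum => i _; move: (sigmoid_gt0 (V i 0 ^+ 2)) (sigmoid_lt1 (V i 0 ^+ 2)).
case: (I01 i) => ->; nra.
Qed.

End fidelity_theory.

Section regularizer_theory.
Context {R : realType} {n : nat} {bc : boundary} {beta1 beta2 : R}.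
Implicit Types U : 'cV[R]_(n * n).

Definition unit_box {m} : set 'cV[R]_m := [set U | forall i, 0 <= U i 0 <= 1].

(** The finite branch of [regularizer], taken on the whole space so that it is continuous there and
    not merely on the box. *)
Definition regularizer_density U : R :=
  beta1 * (l1norm (diff_x n bc *m U) + l1norm (diff_y n bc *m U))
  + beta2 * l1norm (hadamard U (const_mx 1 - U)).

Lemma regularizer_box U : unit_box U ->
  regularizer bc beta1 beta2 U = (regularizer_density U)%:E.
Proof. by move=> boxU; rewrite /regularizer ifT//; apply/forallP. Qed.

Lemma regularizer_nbox U : ~ unit_box U -> regularizer bc beta1 beta2 U = +oo%E.
Proof. by move=> boxU; rewrite /regularizer ifN//; apply/negP => /forallP. Qed.

Lemma regularizer_density_ge0 U : 0 <= beta1 -> 0 <= beta2 ->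
  0 <= regularizer_density U.
Proof. by move=> b1 b2; rewrite addr_ge0 ?mulr_ge0 ?addr_ge0 ?sumr_ge0. Qed.

Lemma regularizer_density_continuous : continuous regularizer_density.
Proof.
move=> U; have cvgU : V @[V --> U] --> U by exact: cvg_id.
have cvgD1 (A : 'M[R]_(n * n)) : l1norm (A *m V) @[V --> U] --> l1norm (A *m U).
  exact: (cvg_l1norm (cvg_mulmx (A := A) cvgU)).
have cvgH : l1norm (hadamard V (const_mx 1 - V)) @[V --> U] -->
    l1norm (hadamard U (const_mx 1 - U)).
  have cvg1U : (const_mx 1 : 'cV[R]_(n * n)) - V @[V --> U] --> const_mx 1 - U.
    exact: (cvgB (cvg_cst _) cvgU).
  exact: (cvg_l1norm (cvg_hadamard cvgU cvg1U)).
exact: (cvgD (cvgM (cvg_cst beta1) (cvgD (cvgD1 (diff_x n bc)) (cvgD1 (diff_y n bc))))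
  (cvgM (cvg_cst beta2) cvgH)).
Qed.

Lemma unit_box_closed m : closed (@unit_box m).
Proof.
have -> : @unit_box m = \bigcap_(i in setT) ((fun U : 'cV[R]_m => U i 0) @^-1` `[0, 1]).
  apply/seteqP; split=> U boxU i; first by move=> _; rewrite /= in_itv; exact: boxU.
  by have := boxU i Logic.I; rewrite /= in_itv.
apply: closed_bigI => i _.
by apply: (continuous_closedP _).1; [exact: coord_continuous|exact: itv_closed].
Qed.

End regularizer_theory.

(** Comparing the all-ones vector with 0, which are distinct in positive dimension, forces the sign
    of [k]. *)
Lemma l2_lipschitz_ge0 (R : realType) (m : nat) (k : R)
    (G : 'cV[R]_m -> 'cV[R]_m) : (0 < m)%N -> l2_lipschitz k G -> 0 <= k.
Proof.
case: m G => // m G _ lipG.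
have := le_trans (l2norm_ge0 _) (lipG (const_mx 1) 0).
rewrite subr0 pmulr_lge0// (lt_le_trans _ (coord_le_l2norm _ 0))//.
by rewrite mxE normr1.
Qed.

Theorem theorem3p1 (R : realType) (n : nat) (hn : (1 <= n)%N) (bc : boundary)
    (a tr beta1 beta2 rho : R)
    (ha : 0 < a) (hbeta1 : 0 < beta1) (hbeta2 : 0 < beta2) (hrho : 0 < rho)
    (I : 'cV[R]_(n * n)) (hI : forall i, I i 0 = 0 \/ I i 0 = 1)
    (H : 'M[R]_(n * n)) :
  let f := regularizer bc beta1 beta2 in
  let h := fidelity a tr I in
  let L := aug_lagrangian f h H rho in
  forall (Lh : R), l2_lipschitz Lh (gradient h) ->
  forall (U V P : nat -> 'cV[R]_(n * n)), admm L H rho U V P ->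
  0 < rho / 2 - Lh / rho - Lh ->
  exists (phi : nat -> nat) (Us Vs Ps : 'cV[R]_(n * n)),
    [/\ increasing_seq phi,
        U (phi k) @[k --> \oo] --> Us,
        V (phi k) @[k --> \oo] --> Vs,
        P (phi k) @[k --> \oo] --> Ps &
        stationary L Us Vs Ps].
Proof.
move=> f h L Lh lip_h U V P run rho_Lh.
have Lh0 : 0 <= Lh by apply: l2_lipschitz_ge0 lip_h; rewrite muln_gt0 hn.
have Lh_rho : 2 * Lh < rho.
  have : 0 <= Lh / rho by rewrite divr_ge0// ltW.
  lra.
(* [M] is the number of pixels, each contributing at most 1 to the fidelity, and [B = 1] bounds the
   entries of points of the unit box. *)
apply: (admm_stationary_subsequence
  (g := regularizer_density (bc := bc) (beta1 := beta1) (beta2 := beta2))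
  (K := unit_box) (M := (n * n)%:R) (k := Lh) (B := 1)
  _ _ _ hrho _ _ _ Lh0 Lh_rho lip_h _ _ _ run).
- exact: regularizer_box.
- exact: regularizer_nbox.
- exact: fidelity_differentiable.
- by exists 0 => i; rewrite mxE lexx ler01.
- by move=> W _; apply: regularizer_density_ge0; exact: ltW.
- by move=> W; exact: fidelity_bounds.
- exact: unit_box_closed.
- exact: regularizer_density_continuous.
- by move=> W i /(_ i)/andP[W0 W1]; rewrite ger0_norm.
Qed.
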